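(* Let $M$ be an Orlicz function equivalent to the function $t/\log(e/t)$ for small $t>0$. Let $\{h_k\}_{k\ge1}$ and $\{g_k\}_{k\ge1}$ be sequences of pairwise disjoint measurable subsets of $(0,1)$ with $\lambda(h_k)=2^{-k-2^k}$ and $\lambda(g_k)=4^{-k-4^k}$, and put $$x=\sum_{k=1}^\infty 2^{2^k}\chi_{h_k},\qquad y=\sum_{k=1}^\infty 4^{4^k}\chi_{g_k}.$$ Then for every finitely supported scalar sequence $a=(a_k)_{k=1}^\infty$ we have $$\Big\|\sum_{k=1}^\infty a_k\overline{x}_k\Big\|_{L_1+L_2}\sim\Big\|\sum_{k=1}^\infty a_k\overline{y}_k\Big\|_{L_1+L_2}\sim\|a\|_{l_M},$$ with equivalence constants independent of $a$.
   Context: $\lambda$ is Lebesgue measure and $\chi_c$ is the indicator function of a set $c$. For $f\in L_1(0,1)$ and $k\in\mathbb N$, $\overline f_k$ is the function on $(0,\infty)$ with $\overline f_k(t)=f(t-k+1)$ for $t\in[k-1,k)$ and $\overline f_k(t)=0$ otherwise. $L_1+L_2=(L_1+L_2)(0,\infty)$ is the Banach sum of $L_1(0,\infty)$ and $L_2(0,\infty)$, with norm $\|z\|_{L_1+L_2}=\inf\{\|u\|_1+\|v\|_2: z=u+v\}$. An Orlicz function is an increasing convex function $M:[0,\infty)\to[0,\infty)$ with $M(0)=0$; throughout $M$ is assumed to satisfy $M(1)=1$ and to be a bijection of $[0,\infty)$. $l_M$ is the Orlicz sequence space with norm $\|a\|_{l_M}=\inf\{\rho>0:\sum_{n}M(|a_n|/\rho)\le1\}$.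 $F\sim G$ (''equivalent'') means $C^{-1}F\le G\le CF$ for some constant $0<C<\infty$; equivalence for small $t>0$ means that these inequalities hold for all $0<t\le t_0$ for some $t_0>0$. *)

(* Defs.v *)
From HB Require Import structures.
From mathcomp Require Import all_boot all_order all_algebra.
From mathcomp Require Import all_classical all_reals all_analysis.

Set Implicit Arguments.
Unset Strict Implicit.
Unset Printing Implicit Defensive.

Import Order.TTheory GRing.Theory Num.Theory.
Import numFieldNormedType.Exports.

Local Open Scope classical_set_scope.
Local Open Scope ring_scope.

(* All sequences are indexed from 1: the term of index 0 is never used. *)

(* The real line with its Lebesgue-measurable (and not only Borel) sets. *)
Notation lebesgueType R := (caratheodory_type (@wlength R idfun)^*%mu).

Lemma measurable_positive (R : realType) :
  measurable (`]0, +oo[%classic : set (lebesgueType R)).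
Proof. by apply: sub_caratheodory; exact: measurable_itv. Qed.

(* Lebesgue measure on (0, +oo), as a measure on the whole line that vanishes
   on its complement. *)
Definition lebesgue_positive (R : realType) :
    {measure set (lebesgueType R) -> \bar R} :=
  mrestr (@completed_lebesgue_measure R) (@measurable_positive R).

(* Functions on (0, +oo) are represented by functions on R; their values
   outside of (0, +oo) are irrelevant. The decomposition z = u + v is an
   equality in the space of classes of functions, i.e., almost everywhere. *)
Definition L1L2_norm (R : realType) (z : lebesgueType R -> R) : \bar R :=
  let mu := lebesgue_positive R in
  ereal_inf [set r | exists u v : lebesgueType R -> R,
    [/\ u \in Lfun mu 1%E, v \in Lfun mu 2%:E,
        {ae mu, forall t, z t = u t + v t} &
        r = ('N[mu]_1%E[EFin \o u] + 'N[mu]_(2%:E)[EFin \o v])%E]].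

Definition shift_copy (R : realType) (f : R -> R) (k : nat) (t : R) : R :=
  if k%:R - 1 <= t < k%:R then f (t - k%:R + 1) else 0.

Definition copies_sum (R : realType) (f : R -> R) (a : nat -> R) (t : R) : R :=
  limn (fun n : nat => \sum_(1 <= k < n) a k * shift_copy f k t : R).

Definition tower_step (R : realType) (b : nat) (c : nat -> set R) (t : R) : R :=
  limn (fun n : nat => \sum_(1 <= k < n) b%:R ^+ (b ^ k) * \1_(c k) t : R).

(* The values of M outside of [0, +oo) are irrelevant. *)
Record Orlicz_function (R : realType) (M : R -> R) : Prop := {
  Orlicz_increasing : {in `[0, +oo[ &, {homo M : s t / s <= t}} ;
  Orlicz_convex : convex_function (`[0, +oo[%classic : set R^o) M ;
  Orlicz0 : M 0 = 0 ;
  Orlicz1 : M 1 = 1 ;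
  Orlicz_bij : set_bij `[0, +oo[%classic `[0, +oo[%classic M }.

Definition Orlicz_norm (R : realType) (M : R -> R) (a : nat -> R) : \bar R :=
  ereal_inf [set rho%:E | rho in [set rho : R |
    0 < rho /\ (\sum_(1 <= n <oo) (M (`|a n| / rho))%:E <= 1)%E]].

Definition equivalent_on (R : realType) (T : Type) (D : set T)
    (F G : T -> \bar R) : Prop :=
  exists2 C : R, 0 < C &
    forall s, D s -> ((C^-1)%:E * F s <= G s <= C%:E * F s)%E.

Definition equivalent_near0 (R : realType) (F G : R -> R) : Prop :=
  exists2 t0 : R, 0 < t0 &
    equivalent_on `]0, t0]%classic (EFin \o F) (EFin \o G).

Definition finitely_supported (R : realType) : set (nat -> R) :=
  [set a | finite_set [set k | a k != 0]].

(* Main.v *)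
(* Cut the weighted copies a_k x_k at height rho. The part above
   rho has L_1-norm and the part below rho has squared L_2-norm bounded by
   multiples of rho * S and rho^2 * S, where S is the sum over k of
   t_k b^-J(t_k), with t_k = |a_k| / rho and J(t) the first level j such that
   t b^(b^j) > 1; both inner sums are geometric, dominated by the level J.
   Conversely, if the combination is u + v with |u|_1 + |v|_2 <= rho, then
   already its restriction to the single level J(t_k) of each copy forces
   S <= 6. Finally b^J(t) is comparable to log (e/t), up to a factor b because
   consecutive heights have logarithms in ratio b, so t b^-J(t) is comparable
   to M t on (0, 1]. *)

Require Import Defs.
From HB Require Import structures.
From mathcomp Require Import all_boot all_order all_algebra.
From mathcomp Require Import all_classical all_reals all_analysis.
From mathcomp Require Import measurable_realfun ring lra.

Import Order.TTheory GRing.Theory Num.Theory.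
Import numFieldNormedType.Exports.

Local Open Scope classical_set_scope.
Local Open Scope ring_scope.

(** * Translation invariance of completed Lebesgue measure *)

Section translation.
Context {R : realType}.
Local Notation leb := ((@wlength R idfun)^*)%mu.
Local Notation shift c := (fun t : R => t - c).

Lemma wlength_shift (c : R) (I : set R) : ocitv I ->
  wlength idfun (shift c @^-1` I) = wlength idfun I.
Proof.
move=> [[p q] _ <-] /=.
have -> : shift c @^-1` `]p, q] = `]p + c, q + c]%classic.
  by apply/seteqP; split => t /=; rewrite !in_itv /= ltrBrDr lerBlDr.
rewrite !wlength_itv /= !lte_fin ltrD2r; case: ifP => // _.
by rewrite !EFinN -!EFinB; congr EFin; rewrite opprD addrACA subrr addr0.
Qed.

Lemma ocitv_shift (c : R) (I : set R) : ocitv I -> ocitv (shift c @^-1` I).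
Proof.
move=> [[p q] _ <-] /=; exists (p + c, q + c) => //=.
by apply/seteqP; split => t /=; rewrite !in_itv /= ltrBrDr lerBlDr.
Qed.

(** Translating a cover by half-open intervals gives a cover of the same total length, whence one
    inequality for every shift; shifting back by [- c] gives the other. *)
Lemma outer_lebesgue_shift (c : R) (X : set R) :
  leb (shift c @^-1` X) = leb X.
Proof.
have le d Y : (leb (shift d @^-1` Y) <= leb Y)%E.
  apply: le_ereal_inf_tmp => _ [B [mB YB] <-]; apply: ereal_inf_lbound.
  exists (fun k => shift d @^-1` (B k)).
    split=> [k|t Yt]; first exact/ocitv_shift/mB.
    by have [k _ Bk] := YB _ Yt; exists k.
  by apply: eq_eseriesr => k _; exact/wlength_shift/mB.
apply/eqP; rewrite eq_le le /=.
rewrite -[in leLHS](_ : shift (- c) @^-1` (shift c @^-1` X) = X) ?le//.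
by apply/seteqP; split => t /=; rewrite opprK addrK.
Qed.

Lemma completed_lebesgue_shift (c : R) (X : set (lebesgueType R)) :
  completed_lebesgue_measure (shift c @^-1` X : set (lebesgueType R)) =
  completed_lebesgue_measure X.
Proof. exact: outer_lebesgue_shift. Qed.

(** Every test set is itself a translate, so the splitting condition for [X] carries over by
    invariance of the outer measure. *)
Lemma caratheodory_shift (c : R) (X : set R) :
  caratheodory_measurable leb X ->
  caratheodory_measurable leb (shift c @^-1` X).
Proof.
move=> mX Y; have [Z ->] : exists Z, Y = shift c @^-1` Z.
  exists (shift (- c) @^-1` Y).
  by apply/seteqP; split => t /=; rewrite opprK subrK.
have := mX Z.
rewrite -(outer_lebesgue_shift c Z) -(outer_lebesgue_shift c (Z `&` X)).
by rewrite -(outer_lebesgue_shift c (Z `&` ~` X)).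
Qed.

Lemma lebesgue_measurable_shift (c : R) (X : set (lebesgueType R)) :
  measurable X -> measurable (shift c @^-1` X : set (lebesgueType R)).
Proof. exact: caratheodory_shift. Qed.

Lemma lebesgue_positiveE (X : set (lebesgueType R)) : X `<=` `]0, +oo[ ->
  lebesgue_positive R X = completed_lebesgue_measure X.
Proof. by move=> X0; rewrite /lebesgue_positive /= /mrestr setIidl. Qed.

End translation.

(** * Integral estimates for functions constant on countably many disjoint pieces *)

Section integral_estimates.
Context d (T : measurableType d) (R : realType).
Variable mu : {measure set T -> \bar R}.

Lemma integral_sqr_Lnorm (f : T -> R) :
  (\int[mu]_t ((f t) ^+ 2)%:E = ('N[mu]_2%:E[EFin \o f]) `^ 2)%E.
Proof.
rewrite poweR_Lnorm//; apply: eq_integral => t _ /=.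
by rewrite powR_mulrn// real_normK// num_real.
Qed.

Lemma Lnorm2_le (f : T -> R) (c : R) : 0 <= c ->
  (\int[mu]_t ((f t) ^+ 2)%:E <= (c ^+ 2)%:E)%E ->
  ('N[mu]_2%:E[EFin \o f] <= c%:E)%E.
Proof.
move=> c0; rewrite integral_sqr_Lnorm.
have := Lnorm_ge0 mu 2%:E (EFin \o f).
case: ('N[mu]_2%:E[EFin \o f])%E => [r||]; rewrite ?leNye//.
  by rewrite !lee_fin => r0; rewrite powR_mulrn// ler_pXn2r// ?nnegrE.
by move=> _; rewrite poweRyr// leye_eq.
Qed.

Lemma integral_scale_indic (c : R) (A : set T) : 0 <= c -> measurable A ->
  (\int[mu]_t (c * \1_A t)%:E = c%:E * mu A)%E.
Proof.
move=> c0 mA; under eq_integral do rewrite EFinM.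
rewrite ge0_integralZl_EFin//; last exact/measurable_EFinP.
by rewrite integral_indic// setIT.
Qed.

(** [f] is at most the sum, over [k < N] and all [j], of [F k j] times the indicator of [D k j].
    Integrating this majorant term by term leaves, for each [k], a series with partial sums at most
    [B k]. *)
Lemma ge0_integral_le_series (N : nat) (D : nat -> nat -> set T)
    (F m : nat -> nat -> R) {B : nat -> R} {f : T -> R} :
  (forall k j, measurable (D k j)) ->
  (forall k j, mu (D k j) = (m k j)%:E) ->
  (forall k j, 0 <= F k j) ->
  measurable_fun setT f -> (forall t, 0 <= f t) ->
  (forall k j t, D k j t -> f t <= F k j) ->
  (forall t, f t != 0 -> exists k j, (k < N)%N /\ D k j t) ->
  (forall k n, \sum_(0 <= j < n) F k j * m k j <= B k) ->
  (\int[mu]_t (f t)%:E <= (\sum_(0 <= k < N) B k)%:E)%E.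
Proof.
move=> mD muD F0 mf f0 fF supp FB.
have mI k j : measurable_fun setT (fun t => (F k j * \1_(D k j) t)%:E).
  by apply/measurable_EFinP/measurable_funM => //; exact: measurable_indic.
have I0 k j t : (0 <= (F k j * \1_(D k j) t)%:E)%E.
  by rewrite lee_fin mulr_ge0.
have S0 k t : (0 <= \sum_(j <oo) (F k j * \1_(D k j) t)%:E)%E.
  exact: nneseries_ge0.
have mS k : measurable_fun setT (fun t => \sum_(j <oo) (F k j * \1_(D k j) t)%:E)%E.
  by apply: (ge0_emeasurable_sum (P := xpredT)).
apply: (@le_trans _ _ (\int[mu]_t
    (\sum_(0 <= k < N) \sum_(j <oo) (F k j * \1_(D k j) t)%:E)))%E.
  apply: ge0_le_integral => //.
  - by move=> t _; rewrite lee_fin.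
  - exact/measurable_EFinP.
  - by apply: emeasurable_sum => k; exact: mS.
  move=> t _; have [->|ft] := eqVneq (f t) 0; first by rewrite sume_ge0.
  have [k [j [kN Dt]]] := supp _ ft.
  rewrite (bigD1_seq k) ?mem_index_iota ?iota_uniq//=.
  rewrite -[leLHS]adde0 leeD ?sume_ge0//.
  apply: (@le_trans _ _ (\sum_(0 <= i < j.+1) (F k i * \1_(D k i) t)%:E))%E.
    rewrite big_nat_recr//= -[leLHS]add0e leeD ?sume_ge0//.
    by rewrite indicE mem_set// mulr1 lee_fin fF.
  exact: nneseries_lim_ge.
rewrite ge0_integral_sum// -sumEFin; apply: lee_sum => k _.
rewrite integral_nneseries//.
under eq_eseriesr do rewrite integral_scale_indic// muD -EFinM.
apply: lime_le.
  apply: is_cvg_nneseries => j _ _; rewrite EFinM mule_ge0 ?lee_fin//.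
  by rewrite -lee_fin -muD.
by apply: nearW => n; rewrite sumEFin lee_fin.
Qed.

Variables (D : nat -> nat -> set T) (w q a : nat -> R) (z : T -> R).
Hypothesis mD : forall k j, measurable (D k j).
Hypothesis tD : trivIset setT (fun p : nat * nat => D p.1 p.2).
Hypothesis w0 : forall j, 0 < w j.
Hypothesis muD : forall k j, mu (D k j) = (q j / w j)%:E.
Hypothesis zD : forall k j t, D k j t -> z t = a k * w j.
Hypothesis z_supp : forall t, z t != 0 -> exists k j, D k j t.

Lemma step_index_inj {k k' j j' : nat} {t : T} : D k j t -> D k' j' t ->
  k = k' /\ j = j'.
Proof.
move=> Dt Dt'; have [] : (k, j) = (k', j') by apply: tD => //; exists t.
by [].
Qed.

(** By disjointness the finite sums [s n] are eventually constant at each point, so [z] is a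
    pointwise limit of measurable functions. *)
Lemma measurable_step : measurable_fun setT z.
Proof.
pose s n t := \sum_(0 <= k < n) \sum_(0 <= j < n) a k * w j * \1_(D k j) t.
apply: (@measurable_fun_cvg _ _ _ _ s).
  move=> n; do 2 apply: measurable_sum => ?.
  by apply: measurable_funM => //; exact: measurable_indic.
move=> t _; have [[k [j Dt]]|nD] := pselect (exists k j, D k j t).
  apply: cvg_near_cst; exists (maxn k j).+1 => // n /=.
  rewrite gtn_max => /andP[kn jn].
  rewrite (zD _ _ _ Dt) /s (bigD1_seq k) ?mem_index_iota ?iota_uniq//=.
  rewrite [X in _ + X]big1 ?addr0; last first.
    move=> k' /eqP kk'; rewrite big1// => j' _.
    rewrite indicE memNset ?mulr0// => Dt'.
    by apply: kk'; have [] := step_index_inj Dt' Dt.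
  rewrite (bigD1_seq j) ?mem_index_iota ?iota_uniq//=.
  rewrite big1 ?addr0; first by rewrite indicE mem_set// mulr1.
  move=> j' /eqP jj'; rewrite indicE memNset ?mulr0// => Dt'.
  by apply: jj'; have [] := step_index_inj Dt' Dt.
apply: cvg_near_cst; apply: nearW => n.
have -> : z t = 0 by apply: contra_notP nD => /eqP; exact: z_supp.
rewrite /s big1// => k _; rewrite big1// => j _.
by rewrite indicE memNset ?mulr0// => Dt; apply: nD; exists k, j.
Qed.

(** As [D k j] has measure [q j / w j], the integrals of [|z|] and [z^2] over it are [|a k| q j] and
    [|a k|^2 w j q j], the terms summed in the two hypotheses on [m]. Each of the two norms is at
    most [C * rho]. *)
Lemma truncation_norms (N : nat) (m : nat -> R) (C rho : R) :
  0 < rho -> 1 <= C -> (forall k, (N <= k)%N -> a k = 0) ->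
  (forall k n, \sum_(0 <= j < n | rho < `|a k| * w j) `|a k| * q j
     <= rho * m k) ->
  (forall k n, \sum_(0 <= j < n | `|a k| * w j <= rho) `|a k| ^+ 2 * w j * q j
     <= rho ^+ 2 * m k) ->
  \sum_(0 <= k < N) m k <= C ->
  exists u v : T -> R, [/\ u \in Lfun mu 1%E, v \in Lfun mu 2%:E,
    forall t, z t = u t + v t &
    ('N[mu]_1%E[EFin \o u] + 'N[mu]_(2%:E)[EFin \o v] <= (2 * C * rho)%:E)%E].
Proof.
move=> rho0 C1 aN hu hv hm; have mz := measurable_step.
pose u t := if `|z t| <= rho then 0 else z t.
pose v t := if `|z t| <= rho then z t else 0.
have mle : measurable_fun setT (fun t => `|z t| <= rho).
  by apply: measurable_fun_ler => //; exact: measurableT_comp.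
have mu_ : measurable_fun setT u by apply: measurable_fun_ifT.
have mv : measurable_fun setT v by apply: measurable_fun_ifT.
have supp t : z t != 0 -> exists k j, (k < N)%N /\ D k j t.
  move=> zt; have [k [j Dt]] := z_supp _ zt; exists k, j; split => //.
  by rewrite ltnNge; apply: contra zt => /aN ak; rewrite (zD _ _ _ Dt) ak mul0r.
have Nu : ('N[mu]_1%E[EFin \o u] <= (C * rho)%:E)%E.
  rewrite Lnorm1; apply: (@le_trans _ _ (\sum_(0 <= k < N) rho * m k)%:E);
    last by rewrite -mulr_sumr lee_fin mulrC ler_pM2r.
  apply: (ge0_integral_le_series N D
    (fun k j => if rho < `|a k| * w j then `|a k| * w j else 0)
    (fun k j => q j / w j)) => //.
  - by move=> k j; case: ifP => // _; rewrite mulr_ge0// ltW.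
  - exact: measurableT_comp.
  - move=> k j t Dt; rewrite /u (zD _ _ _ Dt) normrM (gtr0_norm (w0 j)) real_ltNge ?num_real//.
    by case: ifP => _ /=; rewrite ?normr0// normrM (gtr0_norm (w0 j)).
  - by move=> t; rewrite normr_eq0 /u; case: ifP; rewrite ?eqxx// => _ /supp.
  - move=> k n; apply: le_trans (hu k n).
    rewrite [leRHS]big_mkcond/= le_eqVlt; apply/orP; left; apply/eqP.
    apply: eq_bigr => j _; case: ifP => _; last by rewrite mul0r.
    by field; rewrite gt_eqF.
have Nv : ('N[mu]_(2%:E)[EFin \o v] <= (C * rho)%:E)%E.
  apply: Lnorm2_le; first by rewrite mulr_ge0 ?ltW// (lt_le_trans ltr01).
  (* The squared norm is bounded by [rho ^+ 2 * C]; [1 <= C] turns this into [rho ^+ 2 * C ^+ 2]. *)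
  apply: (@le_trans _ _ (\sum_(0 <= k < N) rho ^+ 2 * m k)%:E); last first.
    rewrite -mulr_sumr lee_fin exprMn mulrC ler_pM2r ?exprn_gt0//.
    by rewrite (le_trans hm)// expr2 ler_peMr// (le_trans ler01).
  apply: (ge0_integral_le_series N D
    (fun k j => if `|a k| * w j <= rho then (`|a k| * w j) ^+ 2 else 0)
    (fun k j => q j / w j)) => //.
  - by move=> k j; case: ifP => // _; rewrite sqr_ge0.
  - exact: measurable_funX.
  - by move=> t; rewrite sqr_ge0.
  - move=> k j t Dt; rewrite /v (zD _ _ _ Dt) normrM (gtr0_norm (w0 j)).
    by case: ifP => _; rewrite ?expr0n// !exprMn real_normK ?num_real.
  - by move=> t; rewrite sqrf_eq0 /v; case: ifP; rewrite ?eqxx// => _ /supp.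
  - move=> k n; apply: le_trans (hv k n).
    rewrite [leRHS]big_mkcond/= le_eqVlt; apply/orP; left; apply/eqP.
    apply: eq_bigr => j _; case: ifP => _; last by rewrite mul0r.
    by field; rewrite gt_eqF.
exists u, v; split.
- by rewrite inE; apply/andP; split; rewrite inE//; exact: le_lt_trans Nu (ltry _).
- by rewrite inE; apply/andP; split; rewrite inE//; exact: le_lt_trans Nv (ltry _).
- by move=> t; rewrite /u /v; case: ifP => _; rewrite ?addr0 ?add0r.
- by apply: le_trans (leeD Nu Nv) _; rewrite -EFinD lee_fin -mulrA mulr_natl mulr2n.
Qed.

(* On the k-th piece keep only one level J k, high enough for |z| >= rho
   there; then |z| <= 2 |u| + 4 v^2 / rho on the union of these levels. *)
Lemma decomposition_lower_bound (u v : T -> R) (rho : R) (n : nat)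
    (J : nat -> nat) :
  0 < rho -> u \in Lfun mu 1%E -> v \in Lfun mu 2%:E ->
  {ae mu, forall t, z t = u t + v t} ->
  ('N[mu]_1%E[EFin \o u] + 'N[mu]_(2%:E)[EFin \o v] <= rho%:E)%E ->
  (forall k, a k != 0 -> rho <= `|a k| * w (J k)) ->
  \sum_(0 <= k < n) `|a k| * q (J k) <= 6 * rho.
Proof.
move=> rho0 uL vL zuv Nuv hJ.
have mfu : measurable_fun setT u by apply: set_mem; exact: (sub_Lfun_mfun uL).
have mfv : measurable_fun setT v by apply: set_mem; exact: (sub_Lfun_mfun vL).
have mI k : measurable_fun setT
    (fun t => (`|a k| * w (J k) * \1_(D k (J k)) t)%:E).
  by apply/measurable_EFinP/measurable_funM => //; exact: measurable_indic.
have c0 k : 0 <= `|a k| * w (J k) by rewrite mulr_ge0// ltW.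
have I0 k t : (0 <= (`|a k| * w (J k) * \1_(D k (J k)) t)%:E)%E.
  by rewrite lee_fin mulr_ge0.
have mu1 : measurable_fun setT (fun t => (2 * `|u t|)%:E).
  by apply/measurable_EFinP/measurable_funM => //; exact: measurableT_comp.
have mv2 : measurable_fun setT (fun t => (4 / rho * v t ^+ 2)%:E).
  by apply/measurable_EFinP/measurable_funM => //; exact: measurable_funX.
have r4 : 0 <= 4 / rho by rewrite divr_ge0// ltW.
have key : (\int[mu]_t (\sum_(0 <= k < n) (`|a k| * w (J k) * \1_(D k (J k)) t)%:E)
    <= \int[mu]_t ((2 * `|u t|)%:E + (4 / rho * v t ^+ 2)%:E))%E.
  apply: ae_ge0_le_integral => //.
  - by move=> t _; exact: sume_ge0.
  - by apply: emeasurable_sum => k; exact: mI.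
  - by move=> t _; rewrite -EFinD lee_fin addr_ge0// mulr_ge0// sqr_ge0.
  - exact: emeasurable_funD.
  apply: filterS zuv => t zt _; rewrite sumEFin -EFinD lee_fin.
  have [[k [kn [ak Dt]]]|nD] := pselect (exists k, (k < n)%N /\ a k != 0 /\ D k (J k) t).
    rewrite (bigD1_seq k) ?mem_index_iota ?iota_uniq//=.
    rewrite [X in _ + X]big1 ?addr0; last first.
      move=> k' /eqP kk'; rewrite indicE memNset ?mulr0// => Dt'.
      by apply: kk'; have [] := step_index_inj Dt' Dt.
    rewrite indicE mem_set// mulr1.
    have : rho <= `|z t| by rewrite (zD _ _ _ Dt) normrM (gtr0_norm (w0 _)) hJ.
    rewrite -(gtr0_norm (w0 (J k))) -normrM -(zD _ _ _ Dt).
    have : `|z t| <= `|u t| + `|v t| by rewrite zt ler_normD.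
    rewrite -[v t ^+ 2]real_normK ?num_real//.
    move: (normr_ge0 (u t)) (normr_ge0 (v t)); set Z := `|z t|.
    set U := `|u t|; set V := `|v t| => U0 V0 ZUV rZ.
    rewrite [4 / rho * _]mulrAC.
    rewrite -lerBlDl ler_pdivlMr//.
    (* Either [Z <= 2 * U], or [V > Z / 2] and then [4 * V ^+ 2 >= Z ^+ 2 >= rho * Z]. *)
    have [ZU|UZ] := leP Z (2 * U); nra.
  rewrite big1_seq; first by rewrite addr_ge0// mulr_ge0// sqr_ge0.
  move=> k; rewrite mem_index_iota => /= kn.
  have [->|ak] := eqVneq (a k) 0; first by rewrite normr0 !mul0r.
  by rewrite indicE memNset ?mulr0// => Dt; apply: nD; exists k.
move: key; rewrite ge0_integral_sum// ge0_integralD//; last first.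
  by move=> t _; rewrite lee_fin mulr_ge0// sqr_ge0.
under eq_integral do rewrite EFinM.
under [X in (_ <= _ + X)%E]eq_integral do rewrite EFinM.
rewrite ge0_integralZl_EFin//; last first.
  by apply/measurable_EFinP; exact: measurableT_comp.
rewrite ge0_integralZl_EFin//; last 2 first.
- by move=> t _; rewrite lee_fin sqr_ge0.
- by apply/measurable_EFinP; exact: measurable_funX.
rewrite integral_sqr_Lnorm.
have -> : (\int[mu]_t (`|u t|)%:E = 'N[mu]_1%E[EFin \o u])%E by rewrite Lnorm1.
move: Nuv (Lnorm_ge0 mu 1%E (EFin \o u)) (Lnorm_ge0 mu 2%:E (EFin \o v)).
case: ('N[mu]_1%E[EFin \o u])%E => [x||]//; last first.
  by case: ('N[mu]_2%:E[EFin \o v])%E => [y||]//.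
case: ('N[mu]_2%:E[EFin \o v])%E => [y||]//.
rewrite -EFinD !lee_fin => xy x0 y0.
under eq_bigr do rewrite integral_scale_indic// muD -EFinM.
rewrite poweR_EFin powR_mulrn// sumEFin -!EFinM -EFinD lee_fin.
rewrite (eq_bigr (fun k => `|a k| * q (J k))); last first.
  by move=> k _; field; rewrite gt_eqF.
move/le_trans; apply.
(* The constant is 6 = 2 + 4: [x] and [y] are nonnegative and at most [rho], so [2 * x <= 2 * rho]
   and [4 * y ^+ 2 / rho <= 4 * rho]. *)
have -> : 4 / rho * y ^+ 2 = 4 * y ^+ 2 / rho by rewrite mulrAC.
rewrite -lerBrDl ler_pdivrMr//; nra.
Qed.

End integral_estimates.

(** * Heights [w j], weights [q j], and the level of a positive number *)

Section levels.
Context {R : realType}.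
Variable b : nat.
Hypothesis b2 : (2 <= b)%N.
Local Notation w j := (b%:R ^+ (b ^ j.+1) : R).
Local Notation q j := (b%:R ^- j.+1 : R).

Let b2r : 2 <= b%:R :> R. Proof. by rewrite ler_nat. Qed.
Let b0r : 0 < b%:R :> R. Proof. exact: lt_le_trans b2r. Qed.
Let q0 j : 0 < q j. Proof. by rewrite invr_gt0 exprn_gt0. Qed.
Let w0 j : 0 < w j. Proof. by rewrite exprn_gt0. Qed.
Let qS j : q j = b%:R * q j.+1.
Proof. by rewrite [in RHS]exprS invfM mulVKf// gt_eqF. Qed.

Lemma height_homo : {homo (fun j => w j) : i j / (i <= j)%N >-> i <= j}.
Proof.
move=> i j ij; rewrite ler_weXn2l ?leq_exp2l ?ltnS//.
by apply: le_trans b2r; rewrite ler1n.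
Qed.

(* J is the first index j with t * w j > 1, the heights w being increasing. *)
Definition is_level (t : R) (J : nat) := forall j, (1 < t * w j) = (J <= j)%N.

Lemma exists_level (t : R) : 0 < t -> exists J, is_level t J.
Proof.
move=> t0; have exJ : exists j, 1 < t * w j.
  (* With [j] the integer part of [1 / t], using [n < b ^ n] twice gives
     [1 / t < j + 1 < b ^ (b ^ (j + 1))]. *)
  exists (Num.truncn t^-1); rewrite mulrC -ltr_pdivrMr// div1r.
  apply: lt_le_trans (truncnS_gt t^-1) _.
  rewrite -natrX ler_nat (leq_trans (ltnW (ltn_expl _ b2)))//.
  exact/ltnW/ltn_expl.
exists (ex_minn exJ) => j; case: ex_minnP => J tJ minJ.
apply/idP/idP => [/minJ//|Jj]; apply: lt_le_trans tJ _.
by rewrite ler_pM2l// height_homo.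
Qed.

Lemma sum_tail (J n : nat) : \sum_(0 <= j < n | (J <= j)%N) q j <= 2 * q J.
Proof.
(* Subtracting a remainder makes the induction close: the new term [q n] is paid for by the drop
   from [2 * q n] to [2 * q n.+1], because [2 * q n.+1 <= q n]. *)
suff : \sum_(0 <= j < n | (J <= j)%N) q j <= 2 * q J - 2 * q (maxn J n).
  by move/le_trans; apply; rewrite gerBl mulr_ge0// ltW.
elim: n => [|n IH]; first by rewrite big_nil maxn0 subrr.
rewrite big_mkcond big_nat_recr//= -big_mkcond; case: leqP => Jn.
  rewrite (maxn_idPr _) ?leqW//; move: IH; rewrite (maxn_idPr _)//.
  have : 2 * q n.+1 <= q n by rewrite (qS n) ler_pM2r.
  lra.
by rewrite addr0 (le_trans IH)// (maxn_idPl (ltnW Jn)) (maxn_idPl Jn).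
Qed.

Lemma sum_truncated (f : nat -> R) (J n : nat) : (forall j, 0 <= f j) ->
  \sum_(0 <= j < n | (j < J)%N) f j <= \sum_(0 <= j < J) f j.
Proof.
move=> f0; have [nJ|Jn] := leqP n J.
  rewrite (big_cat_nat (leq0n n) nJ)/= -[leLHS]addr0 lerD ?sumr_ge0//.
  by rewrite big_mkcond ler_sum// => j _; case: ifP.
by rewrite [leRHS](big_nat_widen _ _ _ _ _ (ltnW Jn)).
Qed.

(** The terms at least double at each step, so the last one dominates. *)
Lemma sum_head (n : nat) :
  \sum_(0 <= j < n.+1) w j * q j <= 2 * (w n * q n).
Proof.
elim: n => [|n IH]; first by rewrite big_nat1; have := mulr_gt0 (w0 0) (q0 0); lra.
rewrite big_nat_recr//=; suff : 2 * (w n * q n) <= w n.+1 * q n.+1 by lra.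
rewrite (qS n) !mulrA ler_pM2r//.
(* Doubling amounts to [2 * b * w n <= w n.+1], which follows from [2 * b <= b ^ 2] and
   [b ^ n.+1 + 2 <= b ^ n.+2]. *)
apply: (@le_trans _ _ (b%:R ^+ (b ^ n.+1 + 2))).
  rewrite exprD mulrAC [leRHS]mulrC ler_pM2r// expr2 ler_pM2r//.
rewrite ler_weXn2l//; first by apply: le_trans b2r; rewrite ler1n.
rewrite (expnS b n.+1); apply: (@leq_trans (2 * b ^ n.+1)); last by rewrite leq_mul2r b2 orbT.
rewrite mul2n -addnn leq_add2l (leq_trans b2)// -[leqLHS]expn1 leq_exp2l//.
Qed.

(** The sum runs over [j >= J], so it is a geometric tail. Its constant 2 is relaxed to [2 * b] to
    agree with the sum below the cut. *)
Lemma level_sum_above (t : R) (J n : nat) : 0 < t -> is_level t J ->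
  \sum_(0 <= j < n | 1 < t * w j) t * q j <= 2 * b%:R * (t * q J).
Proof.
move=> t0 lJ; rewrite -mulr_sumr (eq_bigl (fun j => (J <= j)%N)); last exact: lJ.
rewrite mulrCA ler_pM2l// (le_trans (sum_tail J n))// ler_pM2r//.
by have := b2r; lra.
Qed.

(** The sum runs over [j < J] and is dominated by its last index [m = J - 1]. There [t * w m <= 1]
    absorbs the height, leaving [t * q m = b * t * q J]; for [J = 0] the sum is empty. *)
Lemma level_sum_below (t : R) (J n : nat) : 0 < t -> is_level t J ->
  \sum_(0 <= j < n | t * w j <= 1) t ^+ 2 * w j * q j <= 2 * b%:R * (t * q J).
Proof.
move=> t0 lJ; rewrite (eq_bigl (fun j => (j < J)%N)); last first.
  by move=> j; rewrite leNgt lJ ltnNge.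
under eq_bigr do rewrite -mulrA.
rewrite -mulr_sumr.
apply: (@le_trans _ _ (t ^+ 2 * \sum_(0 <= j < J) w j * q j)).
  rewrite ler_pM2l ?exprn_gt0//; apply: sum_truncated => j.
  by rewrite mulr_ge0// ltW.
case: J lJ => [|m] lJ.
  by rewrite big_nil mulr0 !mulr_ge0// ltW.
apply: (@le_trans _ _ (t ^+ 2 * (2 * (w m * q m)))).
  by rewrite ler_pM2l ?exprn_gt0//; exact: sum_head.
have : t * w m <= 1 by rewrite leNgt lJ ltnn.
rewrite -[2 * b%:R * _]mulrA [b%:R * _]mulrCA -qS => tw.
rewrite (_ : t ^+ 2 * _ = 2 * (t * q m * (t * w m))); last by ring.
by rewrite ler_pM2l// ler_piMr// mulr_ge0// ltW.
Qed.

Lemma ln_base_ge : 2^-1 <= ln b%:R :> R.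
Proof.
have : - 2^-1 >= ln (2^-1 : R).
  by rewrite [in leLHS](_ : 2^-1 = 1 + - 2^-1); [apply: le_ln1Dx; lra|lra].
rewrite lnV ?posrE// lerN2 => /le_trans; apply.
by rewrite ler_ln ?posrE.
Qed.

(** Taking logarithms in [1 < t * w J] bounds [- ln t] by [b ^ J.+1 * ln b], and [ln b < b]. *)
Lemma level_log_le (t : R) (J : nat) : 0 < t -> is_level t J ->
  q J * (1 - ln t) <= 1 + b%:R.
Proof.
move=> t0 lJ; have : 1 < t * w J by rewrite lJ.
rewrite -ltr_ln ?posrE ?mulr_gt0// ln1 lnM ?posrE// lnXn// => h.
rewrite mulrC ler_pdivrMr ?exprn_gt0//.
have := ln_sublinear b0r.
have : 1 <= (b ^ J.+1)%:R :> R by rewrite ler1n expn_gt0 (leq_trans _ b2).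
by move: h; rewrite -[_ *+ _]mulr_natr natrX; nra.
Qed.

(** The level before [J] fails, so [- ln t >= b ^ J * ln b >= b ^ J / 2]; for [J = 0],
    [1 - ln s >= 1] is enough. The level is that of [t], which may exceed 1, while the logarithm is
    taken at a smaller [s] in (0, 1]. *)
Lemma level_log_ge (s t : R) (J : nat) : 0 < s -> s <= 1 -> s <= t ->
  is_level t J -> 1 <= 2 * b%:R * (q J * (1 - ln s)).
Proof.
move=> s0 s1 st lJ; have t0 : 0 < t by exact: lt_le_trans st.
have ls : 1 <= 1 - ln s by have := ln_le0 s1; lra.
case: J lJ => [|m] lJ.
  by rewrite expr1 -mulrA mulVKf ?gt_eqF//; lra.
have : t * w m <= 1 by rewrite leNgt lJ ltnn.
rewrite -ler_ln ?posrE ?mulr_gt0// ln1 lnM ?posrE// lnXn// -[_ *+ _]mulr_natr natrX => h.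
have lst : ln s <= ln t by rewrite ler_ln.
rewrite (_ : 2 * _ * _ = 2 * (1 - ln s) * q m); last by rewrite [in RHS]qS; ring.
rewrite ler_pdivlMr ?exprn_gt0// mul1r.
have := ln_base_ge; have : 0 < b%:R ^+ m.+1 :> R by rewrite exprn_gt0.
by move: h; nra.
Qed.

End levels.

(** * Orlicz functions, and the comparison of [M t] with [t * q J] at the level [J] *)

Section orlicz.
Context {R : realType}.
Variable M : R -> R.
Hypothesis hM : Orlicz_function M.

Lemma Orlicz_le (s t : R) : 0 <= s -> s <= t -> M s <= M t.
Proof.
move=> s0 st; apply: (Orlicz_increasing hM) => //; rewrite in_itv/= andbT//.
exact: le_trans st.
Qed.

Lemma Orlicz_ge0 (t : R) : 0 <= t -> 0 <= M t.
Proof. by move=> t0; rewrite -(Orlicz0 hM) Orlicz_le. Qed.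

(** For [t > 1] monotonicity would give [M t = 1 = M 1], against injectivity. *)
Lemma Orlicz_le1 (t : R) : 0 <= t -> M t <= 1 -> t <= 1.
Proof.
move=> t0 Mt; rewrite leNgt; apply/negP => t1.
have [_ Minj _] := Orlicz_bij hM.
suff t1E : t = 1 by rewrite t1E ltxx in t1.
have MtE : M t = M 1.
  by apply/le_anti; rewrite [in leRHS](Orlicz1 hM) Mt Orlicz_le// ltW.
by apply: Minj MtE; rewrite inE/= in_itv/= ?t0 ?ler01.
Qed.

(** Convexity between [s] and 0 with weight [1 / A] on [s], since [M 0 = 0]. *)
Lemma Orlicz_contract (A s : R) : 1 <= A -> 0 <= s -> M (s / A) <= M s / A.
Proof.
move=> A1 s0; have A0 : 0 < A by exact: lt_le_trans A1.
have i0 : 0 <= A^-1 by rewrite invr_ge0 ltW.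
have i1 : A^-1 <= 1 by rewrite invf_le1.
have s_in : (s : R^o) \in (`[0, +oo[%classic : set R^o).
  by rewrite inE/= in_itv/= s0.
have o_in : (0 : R^o) \in (`[0, +oo[%classic : set R^o).
  by rewrite inE/= in_itv/= lexx.
have := Orlicz_convex hM (Itv01 i0 i1) s_in o_in.
rewrite !convRE /= (Orlicz0 hM) mulr0 addr0 [A^-1 * _]mulrC.
rewrite [X in M X <= _ -> _](_ : _ = s / A)//.
by change (A^-1 * s + unstable.onem A^-1 * 0 = s / A); rewrite mulr0 addr0 mulrC.
Qed.

Hypothesis hMeq : equivalent_near0 M (fun t : R => t / ln (expR 1 / t)).

(** Extends the equivalence from small [t] to all of (0, 1], with [log (e/t)] written [1 - ln t] and
    multiplied out. *)
Lemma Orlicz_log : exists2 C : R, 0 < C & forall t : R, 0 < t -> t <= 1 ->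
  M t * (1 - ln t) <= C * t /\ t <= C * (M t * (1 - ln t)).
Proof.
have [t0 t0_gt0 [C C0 hC]] := hMeq.
have lnE (t : R) : 0 < t -> ln (expR 1 / t) = 1 - ln t.
  by move=> ?; rewrite ln_div ?posrE ?expR_gt0// expRK.
have l1 (t : R) : t <= 1 -> 1 <= 1 - ln t by move=> /ln_le0; lra.
have hC' (t : R) : 0 < t -> t <= 1 -> t <= t0 ->
    M t * (1 - ln t) <= C * t /\ t <= C * (M t * (1 - ln t)).
  move=> tgt0 t1 tt0; have lt0 := lt_le_trans ltr01 (l1 _ t1).
  have /hC : `]0, t0]%classic t by rewrite /= in_itv/= tgt0.
  rewrite /= lnE// -!EFinM !lee_fin ler_pdivlMr// ler_pdivrMr//.
  rewrite -mulrA ler_pdivrMl// mulrA => /andP[-> h].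
  by split => //; rewrite mulrA.
pose t1 := Num.min t0 1.
have t1_gt0 : 0 < t1 by rewrite lt_min t0_gt0 ltr01.
have t1_le1 : t1 <= 1 by rewrite ge_min lexx orbT.
have t1_le0 : t1 <= t0 by rewrite ge_min lexx.
have lt1 := l1 _ t1_le1.
have Mt1 : 0 < M t1.
  rewrite lt_neqAle Orlicz_ge0 ?(ltW t1_gt0)// andbT eq_sym.
  apply/eqP => Mt1; have [_] := hC' _ t1_gt0 t1_le1 t1_le0.
  by rewrite Mt1 mul0r mulr0 leNgt t1_gt0.
(* These constants serve on ([t1], 1]: there [M t * (1 - ln t) <= 1 - ln t1 <= A * t], and
   [t <= 1 <= B * M t]. *)
have [A AE] : exists A, A = (1 - ln t1) / t1 by eexists.
have [B BE] : exists B, B = (M t1)^-1 by eexists.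
have A0 : 0 <= A by rewrite AE divr_ge0 ?(ltW t1_gt0)// (le_trans ler01).
have B0 : 0 <= B by rewrite BE invr_ge0 ltW.
exists (C + A + B); first by rewrite -addrA ltr_wpDr// addr_ge0.
move=> t tgt0 tle1; have lt := l1 _ tle1.
have Mt0 : 0 <= M t by rewrite Orlicz_ge0// ltW.
have Ml0 : 0 <= M t * (1 - ln t) by rewrite mulr_ge0// (le_trans ler01).
have [tt1|t1t] := leP t t1.
  have [h1 h2] := hC' _ tgt0 tle1 (le_trans tt1 t1_le0).
  rewrite !mulrDl -!addrA; split.
    by apply: le_trans h1 _; rewrite lerDl addr_ge0// mulr_ge0// ltW.
  by apply: le_trans h2 _; rewrite lerDl addr_ge0// mulr_ge0.
have lnt : ln t1 <= ln t by rewrite ler_ln ?posrE// ltW.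
have MtM : M t1 <= M t by rewrite Orlicz_le ?ltW.
have Mt_le1 : M t <= 1 by rewrite -(Orlicz1 hM) Orlicz_le// ltW.
split.
  apply: (@le_trans _ _ (A * t)).
    rewrite AE mulrAC ler_pdivlMr//; apply: (@le_trans _ _ ((1 - ln t) * t)).
      apply: ler_pM => //; [exact: ltW| |exact: ltW].
      by rewrite -[leRHS]mul1r ler_wpM2r// (le_trans ler01).
    by rewrite ler_wpM2r ?(ltW tgt0)// lerD2l lerN2.
  by rewrite !mulrDl addrAC lerDr addr_ge0// mulr_ge0// ltW.
apply: (@le_trans _ _ (B * (M t * (1 - ln t)))).
  rewrite BE mulrC ler_pdivlMr// mulrC; apply: ler_pM => //; try exact: ltW.
  exact: le_trans lt.
by rewrite !mulrDl lerDr addr_ge0// mulr_ge0// ltW.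
Qed.

Variable b : nat.
Hypothesis b2 : (2 <= b)%N.
Local Notation q j := (b%:R ^- j.+1 : R).

Lemma level_le_Orlicz : exists2 K : R, 0 < K & forall (t : R) J, 0 < t -> t <= 1 ->
  is_level b t J -> t * q J <= K * M t.
Proof.
have [C C0 hC] := Orlicz_log; exists (C * (1 + b%:R)).
  by rewrite mulr_gt0// ltr_wpDr.
move=> t J t0 t1 lJ; have [_ h] := hC _ t0 t1.
have q0 : 0 < q J by rewrite invr_gt0 exprn_gt0// ltr0n (leq_trans _ b2).
apply: (@le_trans _ _ (C * (M t * (1 - ln t)) * q J)).
  by rewrite ler_pM2r.
rewrite -!mulrA ler_pM2l// [leRHS]mulrC ler_wpM2l ?Orlicz_ge0 ?(ltW t0)//.
by rewrite mulrC level_log_le.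
Qed.

(** The argument [s] of [M] is kept apart from [t] so that the bound remains usable at the level of
    some [t > 1]. *)
Lemma Orlicz_le_level : exists2 K : R, 0 < K & forall (s t : R) J, 0 < s -> s <= 1 ->
  s <= t -> is_level b t J -> M s <= K * (s * q J).
Proof.
have [C C0 hC] := Orlicz_log; exists (2 * b%:R * C).
  by rewrite !mulr_gt0// ltr0n (leq_trans _ b2).
move=> s t J s0 s1 st lJ; have [h _] := hC _ s0 s1.
have q0 : 0 < q J by rewrite invr_gt0 exprn_gt0// ltr0n (leq_trans _ b2).
apply: (@le_trans _ _ (M s * (2 * b%:R * (q J * (1 - ln s))))).
  by rewrite ler_peMr ?Orlicz_ge0 ?(ltW s0)// (level_log_ge _ b2 _ _ _ s0 s1 st lJ).
rewrite (_ : M s * _ = 2 * b%:R * q J * (M s * (1 - ln s))); last by ring.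
rewrite (_ : _ * _ * (s * _) = 2 * b%:R * q J * (C * s)); last by ring.
by rewrite ler_pM2l// !mulr_gt0// ltr0n (leq_trans _ b2).
Qed.

End orlicz.

(** * Pointwise values of the shifted copies and of the step functions, as limits of eventually
    constant partial sums *)

Section copies.
Context {R : realType}.

Lemma ge_lt_natr_inj (k k' : nat) (t : R) :
  k%:R <= t < k.+1%:R -> k'%:R <= t < k'.+1%:R -> k = k'.
Proof.
move=> /andP[kt tk] /andP[k't tk']; apply/eqP; rewrite eqn_leq.
have := le_lt_trans kt tk'; have := le_lt_trans k't tk.
by rewrite !ltr_nat !ltnS => -> ->.
Qed.

Lemma shift_copy_in (f : R -> R) (k : nat) (t : R) : k%:R <= t < k.+1%:R ->
  shift_copy f k.+1 t = f (t - k%:R).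
Proof.
rewrite /shift_copy -natr1 addrK => ->.
by rewrite opprD addrA subrK.
Qed.

Lemma shift_copy_out (f : R -> R) (k : nat) (t : R) : ~~ (k%:R <= t < k.+1%:R) ->
  shift_copy f k.+1 t = 0.
Proof. by rewrite /shift_copy -natr1 addrK => /negbTE ->. Qed.

Lemma copies_sum_in (f : R -> R) (a : nat -> R) (k : nat) (t : R) :
  k%:R <= t < k.+1%:R -> copies_sum f a t = a k.+1 * f (t - k%:R).
Proof.
move=> kt; apply: lim_near_cst => //; exists k.+2 => // n /= kn.
rewrite (bigD1_seq k.+1) ?mem_index_iota ?iota_uniq//= shift_copy_in//.
rewrite big1_seq ?addr0// => -[|i]; rewrite mem_index_iota//= => /andP[ik _].
rewrite shift_copy_out ?mulr0//; apply: contra ik => it.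
by rewrite (ge_lt_natr_inj _ _ _ kt it).
Qed.

Lemma copies_sum_neq0 (f : R -> R) (a : nat -> R) (t : R) :
  copies_sum f a t != 0 ->
  exists k, k%:R <= t < k.+1%:R /\ f (t - k%:R) != 0.
Proof.
have [[k kt]|nk] := pselect (exists k, k%:R <= t < k.+1%:R :> bool).
  rewrite (copies_sum_in _ _ _ _ kt) mulf_eq0 negb_or => /andP[_ ft].
  by exists k.
move=> /eqP[]; apply: lim_near_cst => //; apply: nearW => n.
rewrite big1_seq// => -[|i]; rewrite mem_index_iota//= => _.
by rewrite shift_copy_out ?mulr0//; apply/negP => it; apply: nk; exists i.
Qed.

Variables (b : nat) (c : nat -> set R).
Hypothesis c_disj : trivIset [set k : nat | (0 < k)%N] c.

Lemma tower_step_in (k : nat) (t : R) : (0 < k)%N -> c k t ->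
  tower_step b c t = b%:R ^+ (b ^ k).
Proof.
move=> k0 ct; apply: lim_near_cst => //; exists k.+1 => // n /= kn.
rewrite (bigD1_seq k) ?mem_index_iota ?iota_uniq ?k0//= indicE mem_set// mulr1.
rewrite big1_seq ?addr0// => i; rewrite mem_index_iota => /andP[/eqP ik /andP[i0 _]].
rewrite indicE memNset ?mulr0// => cit; apply: ik.
by apply: c_disj => //; exists t.
Qed.

Lemma tower_step_neq0 (t : R) : tower_step b c t != 0 -> exists j, c j.+1 t.
Proof.
apply: contra_neqP => nc; apply: lim_near_cst => //; apply: nearW => n.
rewrite big1_seq// => -[|i]; rewrite mem_index_iota//= => _.
by rewrite indicE memNset ?mulr0// => ct; apply: nc; exists i.
Qed.

End copies.

(** * Symmetry and transitivity of equivalence *)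

Section equivalences.
Context {R : realType} {T : Type} {D : set T}.
Implicit Types F G H : T -> \bar R.

Lemma equivalent_sym {F G} : equivalent_on D F G -> equivalent_on D G F.
Proof.
move=> [C C0 h]; exists C => // s /h /andP[h1 h2]; apply/andP; split.
  by rewrite lee_pdivrMl.
by rewrite -lee_pdivrMl.
Qed.

Lemma equivalent_trans {F G H} :
  equivalent_on D F G -> equivalent_on D G H -> equivalent_on D F H.
Proof.
move=> [C C0 h] [C' C'0 h']; exists (C' * C); first exact: mulr_gt0.
move=> s Ds; have /andP[h1 h2] := h _ Ds; have /andP[h3 h4] := h' _ Ds.
rewrite invfM !EFinM -!muleA; apply/andP; split.
  by apply: le_trans h3; rewrite lee_pmul2l// ?lte_fin ?invr_gt0.
by apply: le_trans h4 _; rewrite lee_pmul2l// lte_fin.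
Qed.

End equivalences.

(** * The two norm inequalities for a general base [b] *)

Section tower_copies.
Context {R : realType}.
Variable M : R -> R.
Hypothesis hM : Orlicz_function M.
Hypothesis hMeq : equivalent_near0 M (fun t : R => t / ln (expR 1 / t)).
Variables (b : nat) (c : nat -> set (lebesgueType R)).
Hypothesis b2 : (2 <= b)%N.
Hypothesis c_meas : forall k, (0 < k)%N -> measurable (c k).
Hypothesis c_sub : forall k, (0 < k)%N -> c k `<=` `]0, 1[%classic.
Hypothesis c_disj : trivIset [set k : nat | (0 < k)%N] c.
Hypothesis c_size : forall k, (0 < k)%N ->
  completed_lebesgue_measure (c k) = (b%:R ^- (k + b ^ k))%:E.

Local Notation mu := (lebesgue_positive R).
Local Notation w := (fun j => b%:R ^+ (b ^ j.+1) : R).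
Local Notation q := (fun j => b%:R ^- j.+1 : R).
Local Notation z a := (copies_sum (tower_step b c) a).

Let b0 : 0 < b%:R :> R. Proof. by rewrite ltr0n (leq_trans _ b2). Qed.
Let w0 j : 0 < w j. Proof. by rewrite exprn_gt0. Qed.
Let q0 j : 0 < q j. Proof. by rewrite invr_gt0 exprn_gt0. Qed.

(** Indices now start from 0: this is the part of the copy of index [k.+1] on which the step
    function has height [w j]. *)
Definition piece (k j : nat) : set (lebesgueType R) :=
  (fun t : R => t - k%:R) @^-1` c j.+1.

Lemma piece_itv (k j : nat) (t : R) : piece k j t -> k%:R <= t < k.+1%:R.
Proof.
move=> /c_sub; rewrite /= in_itv/= => /(_ isT)/andP[h1 h2].
by rewrite -natr1; apply/andP; split; lra.
Qed.

Lemma measurable_piece (k j : nat) : measurable (piece k j).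
Proof. exact/lebesgue_measurable_shift/c_meas. Qed.

Lemma piece_disj : trivIset setT (fun p : nat * nat => piece p.1 p.2).
Proof.
move=> [k j] [k' j'] _ _ [t [/= kt kt']].
have kk : k = k' := ge_lt_natr_inj _ _ _ (piece_itv _ _ _ kt) (piece_itv _ _ _ kt').
subst k'; congr pair; apply: succn_inj; apply: c_disj => //.
by exists (t - k%:R).
Qed.

Lemma measure_piece (k j : nat) : mu (piece k j) = (q j / w j)%:E.
Proof.
rewrite lebesgue_positiveE; last first.
  move=> t /c_sub; rewrite /= !in_itv/= => /(_ isT)/andP[h1 h2].
  by rewrite andbT; apply: le_lt_trans (ler0n _ k) _; lra.
by rewrite completed_lebesgue_shift c_size// exprD invfM.
Qed.

Lemma copies_sum_piece (a : nat -> R) (k j : nat) (t : R) : piece k j t ->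
  z a t = a k.+1 * w j.
Proof.
move=> kt; rewrite (copies_sum_in _ _ _ _ (piece_itv _ _ _ kt)).
by rewrite (tower_step_in _ _ c_disj j.+1).
Qed.

Lemma copies_sum_supp (a : nat -> R) (t : R) : z a t != 0 ->
  exists k j, piece k j t.
Proof.
move=> /copies_sum_neq0[k [_ /tower_step_neq0[j cj]]].
by exists k, j.
Qed.

Lemma finitely_supported_bound (a : nat -> R) : finitely_supported a ->
  exists N, forall k, (N <= k)%N -> a k.+1 = 0.
Proof.
move=> /finite_seqP[s aE]; exists (\max_(i <- s) i) => k Nk.
apply: contrapT => /eqP ak.
have ks : k.+1 \in s by have : [set` s] k.+1 by rewrite -aE.
have : (k.+1 <= \max_(i <- s) i)%N by exact: leq_bigmax_seq.
by move/leq_trans => /(_ _ Nk); rewrite ltnn.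
Qed.

Lemma L1L2_norm_ge0 (f : lebesgueType R -> R) : (0 <= L1L2_norm f)%E.
Proof.
apply: le_ereal_inf_tmp => _ [u [v [_ _ _ ->]]].
by apply: adde_ge0; exact: Lnorm_ge0.
Qed.

Lemma Orlicz_norm_ge0 (a : nat -> R) : (0 <= Orlicz_norm M a)%E.
Proof.
by apply: le_ereal_inf_tmp => _ [rho [rho0 _] <-]; rewrite lee_fin ltW.
Qed.

Lemma L1L2_le_Orlicz : exists2 C : R, 0 < C & forall a,
  finitely_supported a -> (L1L2_norm (z a) <= C%:E * Orlicz_norm M a)%E.
Proof.
have [K K0 hK] := level_le_Orlicz _ hM hMeq _ b2.
(* [2 * b] comes from the level sums and [K] from the comparison with [M]. The truncation bound
   requires a constant at least 1, hence [1 + B], and contributes the factor 2. *)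
pose B := 2 * b%:R * K; have B0 : 0 < B by rewrite !mulr_gt0.
have C0 : 0 < 2 * (1 + B) by rewrite mulr_gt0// addr_gt0.
exists (2 * (1 + B)) => // a /finitely_supported_bound[N aN].
rewrite -lee_pdivrMl//; apply: le_ereal_inf_tmp => _ [rho [rho0 hrho] <-].
rewrite lee_pdivrMl// -EFinM.
have t0 n : 0 <= `|a n| / rho by rewrite divr_ge0// ltW.
have M0 n : 0 <= M (`|a n| / rho) by exact: Orlicz_ge0.
have hN : \sum_(0 <= k < N) M (`|a k.+1| / rho) <= 1.
  rewrite -lee_fin; apply: le_trans hrho.
  rewrite -(big_add1 _ _ 0 N.+1 predT (fun k => M (`|a k| / rho))).
  by rewrite -sumEFin; apply: nneseries_lim_ge => n _ _; rewrite lee_fin.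
(* A single term of [hN] is at most 1, which places the ratio in the range where [hK] applies. *)
have t1 k : `|a k.+1| / rho <= 1.
  have [Nk|kN] := leqP N k; first by rewrite aN// normr0 mul0r.
  apply: (Orlicz_le1 _ hM) => //; apply: le_trans hN.
  by rewrite (bigD1_seq k) ?mem_index_iota ?iota_uniq//= lerDl sumr_ge0.
have aE k : `|a k.+1| = rho * (`|a k.+1| / rho).
  by rewrite mulrCA divff ?mulr1// gt_eqF.
have C1 : 1 <= 1 + B by rewrite lerDl ltW.
have [|||u [v [uL vL zE uv]]] := truncation_norms _ _ _ mu piece w q
    (fun k => a k.+1) (z a) measurable_piece piece_disj w0 measure_piece
    (copies_sum_piece a) (copies_sum_supp a) N
    (fun k => B * M (`|a k.+1| / rho)) (1 + B) rho rho0 C1 aN.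
- move=> k n; have [->|ak] := eqVneq (a k.+1) 0.
    rewrite normr0 mul0r (Orlicz0 hM) !mulr0 big1// => j _.
    by rewrite mul0r.
  have tk0 : 0 < `|a k.+1| / rho by rewrite divr_gt0// normr_gt0.
  have [J lJ] := exists_level _ b2 _ tk0.
  have := aE k; move: tk0 lJ (t1 k); set t := `|a k.+1| / rho => tk0 lJ tk1 ->.
  clearbody t.
  under eq_bigl do rewrite -mulrA ltr_pMr//.
  under eq_bigr do rewrite -mulrA.
  rewrite -mulr_sumr ler_pM2l//; apply: le_trans (level_sum_above _ b2 _ _ n tk0 lJ) _.
  by rewrite /B -[leRHS]mulrA ler_pM2l ?mulr_gt0// hK.
- move=> k n; have [->|ak] := eqVneq (a k.+1) 0.
    rewrite normr0 mul0r (Orlicz0 hM) !mulr0 big1// => j _.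
    by rewrite expr0n/= !mul0r.
  have tk0 : 0 < `|a k.+1| / rho by rewrite divr_gt0// normr_gt0.
  have [J lJ] := exists_level _ b2 _ tk0.
  have := aE k; move: tk0 lJ (t1 k); set t := `|a k.+1| / rho => tk0 lJ tk1 ->.
  clearbody t.
  under eq_bigl do rewrite -mulrA ger_pMr//.
  rewrite (eq_bigr (fun j => rho ^+ 2 * (t ^+ 2 * w j * q j))); last first.
    by move=> j _; rewrite exprMn !mulrA.
  rewrite -mulr_sumr ler_pM2l ?exprn_gt0//.
  apply: le_trans (level_sum_below _ b2 _ _ n tk0 lJ) _.
  by rewrite /B -[leRHS]mulrA ler_pM2l ?mulr_gt0// hK.
- by rewrite -mulr_sumr (@le_trans _ _ B)// ?lerDr// ler_piMr// ltW.
apply: le_trans uv; apply: ereal_inf_lbound; exists u, v; split => //.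
exact: nearW.
Qed.

Lemma Orlicz_le_L1L2 : exists2 C : R, 0 < C & forall a,
  (Orlicz_norm M a <= C%:E * L1L2_norm (z a))%E.
Proof.
have [K K0 hK] := Orlicz_le_level _ hM hMeq _ b2.
(* [6 * b] brings the ratios [|a k| / rho] into [0, 1]; the further contraction by [A >= K] brings
   the sum of the values of [M] below 1. *)
pose A := 1 + K; have A1 : 1 <= A by rewrite lerDl ltW.
pose C := 6 * b%:R * A.
have A0 : 0 < A by exact: lt_le_trans A1.
have C0 : 0 < C by rewrite !mulr_gt0.
exists C => // a; rewrite -lee_pdivrMl//.
apply: le_ereal_inf_tmp => _ [u [v [uL vL zuv ->]]].
rewrite lee_pdivrMl//.
have : (0 <= 'N[mu]_1%E[EFin \o u] + 'N[mu]_(2%:E)[EFin \o v])%E.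
  by apply: adde_ge0; exact: Lnorm_ge0.
case rE : ('N[mu]_1%E[EFin \o u] + 'N[mu]_(2%:E)[EFin \o v])%E => [r||] //; last first.
  by rewrite gt0_muley ?leey// lte_fin.
rewrite lee_fin => r0; apply/lee_addgt0Pr => e e0.
(* [r] may be 0; the added term makes [rho] positive and costs only [e] in [C * rho]. *)
pose rho := r + e / C.
have rho0 : 0 < rho by rewrite ltr_wpDl// divr_gt0.
have -> : (C%:E * r%:E + e%:E = (C * rho)%:E)%E.
  by rewrite -EFinM -EFinD mulrDr mulrCA divff ?mulr1// gt_eqF.
apply: ereal_inf_lbound; exists (C * rho) => //; split; first exact: mulr_gt0.
have t0 n : 0 <= `|a n| / (C * rho) by rewrite divr_ge0// ltW// mulr_gt0.
have M0 n : 0 <= M (`|a n| / (C * rho)) by exact: Orlicz_ge0.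
have /choice[J lJ] : forall k, exists J,
    a k.+1 != 0 -> is_level b (`|a k.+1| / rho) J.
  move=> k; have [->|ak] := eqVneq (a k.+1) 0; first by exists 0%N.
  have tk0 : 0 < `|a k.+1| / rho by rewrite divr_gt0// normr_gt0.
  by have [J lJ] := exists_level _ b2 _ tk0; exists J.
have hsum n : \sum_(0 <= k < n) `|a k.+1| * q (J k) <= 6 * rho.
  apply: (decomposition_lower_bound _ _ _ mu piece w q
    (fun k => a k.+1) (z a) measurable_piece piece_disj w0 measure_piece
    (copies_sum_piece a) u v) => //.
    by rewrite rE lee_fin lerDl divr_ge0// ltW.
  move=> k ak; have := lJ _ ak (J k); rewrite leqnn mulrAC ltr_pdivlMr// mul1r.
  exact: ltW.
(* If [J k = 0], one term of [hsum] with [q 0 = 1 / b] gives the bound. Otherwise the level 0 fails,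
   and [|a k.+1| <= |a k.+1| * w 0 <= rho]. *)
have ak6 k : `|a k.+1| <= 6 * b%:R * rho.
  have [->|ak] := eqVneq (a k.+1) 0.
    by rewrite normr0 ltW// !mulr_gt0.
  have [Jk|Jk] := posnP (J k).
    have := hsum k.+1; rewrite big_nat_recr//= Jk expr1 => h.
    have : `|a k.+1| / b%:R <= 6 * rho.
      by apply: le_trans h; rewrite lerDr sumr_ge0// => i _; rewrite mulr_ge0// ltW.
    by rewrite ler_pdivrMr// mulrAC.
  have := lJ _ ak 0%N; rewrite leqNgt Jk => /negbT; rewrite -leNgt mulrAC ler_pdivrMr// mul1r.
  have w1 : 1 <= w 0%N by rewrite exprn_ege1// ler1n (leq_trans _ b2).
  move=> h; apply: (@le_trans _ _ rho).
    by apply: le_trans h; rewrite ler_peMr.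
  rewrite ler_peMl ?ltW//.
  have : 2 <= b%:R :> R by rewrite ler_nat.
  lra.
apply: lime_le; first by apply: is_cvg_nneseries => n _ _; rewrite lee_fin.
apply: nearW => -[|n]; first by rewrite big_geq.
rewrite sumEFin lee_fin big_add1/=.
(* Termwise, [M (s / A) <= M s / A <= K * s * q (J k) / A] with [s = |a k.+1| / (6 * b * rho)],
   where [J k] is the level of the larger ratio [|a k.+1| / rho]. *)
apply: (@le_trans _ _ (\sum_(0 <= k < n) K / (6 * b%:R * rho * A) * (`|a k.+1| * q (J k)))).
  apply: ler_sum => k _; have [->|ak] := eqVneq (a k.+1) 0.
    by rewrite normr0 !mul0r mulr0 (Orlicz0 hM).
  have s0 : 0 < `|a k.+1| / (6 * b%:R * rho).
    by rewrite divr_gt0 ?normr_gt0// !mulr_gt0.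
  have -> : `|a k.+1| / (C * rho) = `|a k.+1| / (6 * b%:R * rho) / A.
    by rewrite /C; field; rewrite !gt_eqF.
  apply: le_trans (Orlicz_contract _ hM _ _ A1 (ltW s0)) _.
  rewrite ler_pdivrMr//.
  apply: le_trans (hK _ (`|a k.+1| / rho) (J k) s0 _ _ (lJ _ ak)) _.
  - by rewrite ler_pdivrMr ?mul1r// !mulr_gt0.
  - rewrite ler_wpM2l// lef_pV2 ?posrE ?mulr_gt0//.
    rewrite ler_peMl ?ltW//.
    have : 2 <= b%:R :> R by rewrite ler_nat.
    lra.
  - rewrite le_eqVlt; apply/orP; left; apply/eqP; field.
    by rewrite !gt_eqF ?exprn_gt0.
rewrite -mulr_sumr; apply: (@le_trans _ _ (K / (6 * b%:R * rho * A) * (6 * rho))).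
  by rewrite ler_wpM2l// divr_ge0// ltW// !mulr_gt0.
rewrite (_ : _ * _ = K / (b%:R * A)); last by field; rewrite !gt_eqF.
rewrite ler_pdivrMr ?mulr_gt0// mul1r.
apply: (@le_trans _ _ A); first by rewrite lerDr.
by rewrite ler_peMl ?(ltW A0)// ler1n (leq_trans _ b2).
Qed.

Lemma L1L2_equiv_Orlicz : equivalent_on (@finitely_supported R)
  (fun a => L1L2_norm (z a)) (Orlicz_norm M).
Proof.
have [C C0 hC] := L1L2_le_Orlicz; have [K K0 hK] := Orlicz_le_L1L2.
exists (C + K); first exact: addr_gt0.
move=> a fa; apply/andP; split.
  rewrite lee_pdivrMl ?addr_gt0//; apply: le_trans (hC _ fa) _.
  by apply: lee_wpmul2r; [exact: Orlicz_norm_ge0|rewrite lee_fin lerDl ltW].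
apply: le_trans (hK a) _.
by apply: lee_wpmul2r; [exact: L1L2_norm_ge0|rewrite lee_fin lerDr ltW].
Qed.

End tower_copies.

Theorem proposition13 (R : realType) (M : R -> R)
    (h g : nat -> set (lebesgueType R))
    (hM : Orlicz_function M)
    (hMeq : equivalent_near0 M (fun t : R => t / ln (expR 1 / t)))
    (h_meas : forall k, (0 < k)%N -> measurable (h k))
    (g_meas : forall k, (0 < k)%N -> measurable (g k))
    (h_sub : forall k, (0 < k)%N -> h k `<=` `]0, 1[%classic)
    (g_sub : forall k, (0 < k)%N -> g k `<=` `]0, 1[%classic)
    (h_disj : trivIset [set k : nat | (0 < k)%N] h)
    (g_disj : trivIset [set k : nat | (0 < k)%N] g)
    (h_size : forall k, (0 < k)%N ->
      completed_lebesgue_measure (h k) = (2 ^- (k + 2 ^ k))%:E)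
    (g_size : forall k, (0 < k)%N ->
      completed_lebesgue_measure (g k) = (4 ^- (k + 4 ^ k))%:E) :
  let x := tower_step 2 h in
  let y := tower_step 4 g in
  equivalent_on (@finitely_supported R)
    (fun a => L1L2_norm (copies_sum x a)) (fun a => L1L2_norm (copies_sum y a)) /\
  equivalent_on (@finitely_supported R)
    (fun a => L1L2_norm (copies_sum y a)) (Orlicz_norm M).
Proof.
(* The bases 2 and 4 are two instances of one result; the two combinations are then compared through
   the Orlicz norm. *)
have hx := L1L2_equiv_Orlicz _ hM hMeq 2 h isT h_meas h_sub h_disj h_size.
have hy := L1L2_equiv_Orlicz _ hM hMeq 4 g isT g_meas g_sub g_disj g_size.
split; last exact: hy.
apply: equivalent_trans hx _; exact: equivalent_sym hy.
Qed.
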